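(* Let $M$ be a real $n\times n$ matrix, and let $M_s=\frac12(M+M^T)$ and $M_a=\frac12(M-M^T)$ be its symmetric and skew-symmetric parts. If one of the following inequalities holds: (i) $n(\|M_s\|^2-\|M_a\|^2)<\operatorname{Tr}^2(M_s)$; (ii) $n\big(\|M_s^2\|^2+\|M_a^2\|^2-4\|M_sM_a\|^2+2\operatorname{Tr}((M_sM_a)^2)\big)<(\|M_s\|^2-\|M_a\|^2)^2$; (iii) $(\|M_s\|^2-\|M_a\|^2)\big(\|M_s^2\|^2+\|M_a^2\|^2-4\|M_sM_a\|^2+2\operatorname{Tr}((M_sM_a)^2)\big)<\big(\operatorname{Tr}(M_s^3)+3\operatorname{Tr}(M_sM_a^2)\big)^2$, then the matrix $M$ has at least one complex eigenvalue with non-zero imaginary part.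
   Context: For a real matrix $A=[a_{ij}]$, $\|A\|^2=\sum_{i,j}a_{ij}^2=\operatorname{Tr}(AA^T)$ (Frobenius norm). $\operatorname{Tr}^2(A)$ means $(\operatorname{Tr}(A))^2$. *)

(* Defs.v *)
From mathcomp Require Import all_boot all_order all_algebra.
From mathcomp Require Import complex.
From mathcomp Require Import reals.

Set Implicit Arguments.
Unset Strict Implicit.
Unset Printing Implicit Defensive.

Import GRing.Theory Num.Theory.
Local Open Scope ring_scope.

Definition sym_part (R : realType) (n : nat) (M : 'M[R]_n) : 'M[R]_n :=
  2^-1 *: (M + M^T).

Definition skew_part (R : realType) (n : nat) (M : 'M[R]_n) : 'M[R]_n :=
  2^-1 *: (M - M^T).

Definition frobenius_sq (R : realType) (m n : nat) (A : 'M[R]_(m, n)) : R :=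
  \sum_(i < m) \sum_(j < n) A i j ^+ 2.

Definition complexify (R : realType) (n : nat) (M : 'M[R]_n) : 'M[R[i]]_n :=
  map_mx (real_complex R) M.

(* Main.v *)
Require Import Defs.
From mathcomp Require Import all_boot all_order all_algebra.
From mathcomp Require Import complex.
From mathcomp Require Import reals.
From mathcomp Require Import ring lra.

Set Implicit Arguments.
Unset Strict Implicit.
Unset Printing Implicit Defensive.

Import Order.TTheory GRing.Theory Num.Theory.
Local Open Scope ring_scope.

(** Suppose that every complex eigenvalue of [M] is real, and list them with
    multiplicity as [x_1, ..., x_n].  Since [\tr (M ^+ k)] is the power sum
    [x_1 ^+ k + ... + x_n ^+ k], the Cauchy-Schwarz inequality bounds the
    square of a trace of powers by a product of two others:

      - vectors [(1)] and [(x_i)]:     [(\tr M)^2 <= n * \tr M^2];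
      - vectors [(1)] and [(x_i^2)]:   [(\tr M^2)^2 <= n * \tr M^4];
      - vectors [(x_i)] and [(x_i^2)]: [(\tr M^3)^2 <= \tr M^2 * \tr M^4].

    The three hypotheses are exactly the negations of these bounds, once
    [\tr M^k] is expanded in the symmetric part [S] and the skew-symmetric part
    [A] ([mxtrace_sqr_parts], [mxtrace_cube_parts], [mxtrace_pow4_parts]).
    These expansions rest on the trace orthogonality of symmetric and
    skew-symmetric matrices ([mxtrace_sym_skew]): [M^2 = P + Q] with
    [P = S^2 + A^2] symmetric and [Q = S A + A S] skew-symmetric, so that
    mixed terms vanish in each of [\tr M^2], [\tr M^3] and [\tr M^4].

    The power sums come from a Schur triangularization over the complex numbers
    ([mxtrace_expr_eigenvalues]). *)

(** * Traces of powers as power sums of eigenvalues *)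

Lemma trig_mxM (F : comNzRingType) n (A B : 'M[F]_n) :
  is_trig_mx A -> is_trig_mx B ->
  is_trig_mx (A *m B) /\ forall i, (A *m B) i i = A i i * B i i.
Proof.
move=> /is_trig_mxP tA /is_trig_mxP tB; split=> [|i].
  apply/is_trig_mxP => i j lt_ij; rewrite mxE big1 // => k _.
  have [lt_ik|le_ki] := ltnP i k; first by rewrite tA ?mul0r.
  by rewrite tB ?mulr0 // (leq_ltn_trans le_ki).
rewrite mxE (bigD1 i) //= big1 ?addr0 // => k neq_ki.
have [lt_ik|lt_ki|/val_inj eq_ik] := ltngtP i k.
- by rewrite tA ?mul0r.
- by rewrite tB ?mulr0.
- by rewrite eq_ik eqxx in neq_ki.
Qed.

Lemma trig_mxX (F : comNzRingType) n (A : 'M[F]_n) k :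
  is_trig_mx A ->
  is_trig_mx (A ^+ k) /\ forall i, (A ^+ k) i i = A i i ^+ k.
Proof.
move=> tA; elim: k => [|k [tAk dAk]].
  by split=> [|i]; [exact: scalar_mx_is_trig | rewrite expr0 mxE eqxx].
have [tAS dAS] := trig_mxM tA tAk.
by rewrite exprS -mulmxE; split=> // i; rewrite dAS dAk -exprS.
Qed.

(** The [d i] are the diagonal entries of a Schur triangular form of [A]; they
    do not depend on [k] because one basis triangularizes all powers at once. *)
Lemma mxtrace_expr_eigenvalues (C : numClosedFieldType) n (A : 'M[C]_n) :
  exists d : 'I_n -> C,
    (forall i, eigenvalue A (d i)) /\
    (forall k, \tr (A ^+ k) = \sum_i d i ^+ k).
Proof.
have [|P /unitarymx_unit uP] := @cotrigonalization _ n [:: A].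
  by move=> B D; rewrite !inE => /eqP -> /eqP ->.
rewrite /= andbT => tT; set T := conjmx P A in tT.
have defT k : T ^+ k = P *m A ^+ k *m invmx P.
  elim: k => [|k IHk]; first by rewrite !expr0 mulmx1 mulmxV.
  by rewrite !exprS IHk -mulmxE /T conjumx // !mulmxA mulmxKV.
exists (fun i => T i i); split=> [i|k].
  apply: (@eigenvalue_conjmx _ _ _ P); rewrite ?stablemx_unit ?row_free_unit //.
  rewrite -/T [_ \in _]eigenvalue_root_char char_poly_trig // rootE.
  by rewrite horner_prod (bigD1 i) //= !hornerE subrr mul0r.
have -> : \tr (A ^+ k) = \tr (T ^+ k).
  by rewrite defT mxtrace_mulC mulmxA mulVmx // mul1mx.
by apply: eq_bigr => i _; rewrite (trig_mxX k tT).2.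
Qed.

(** When all [d i] are real, the embedding of the reals into the complex numbers
    is injective and sends the traces to the power sums, so the identity holds
    over the reals, where the squares needed below are nonnegative. *)
Lemma nonreal_eigenvalue_or_mxtrace_expr (R : realType) n (M : 'M[R]_n) :
  (exists lambda : R[i],
     eigenvalue (complexify M) lambda /\ complex.Im lambda != 0) \/
  (exists x : 'I_n -> R, forall k, \tr (M ^+ k) = \sum_i x i ^+ k).
Proof.
have [d [eig_d tr_d]] := mxtrace_expr_eigenvalues (complexify M).
have [/forallP real_d|/forallPn[i Im_d]] :=
  boolP [forall i, complex.Im (d i) == 0]; last by left; exists (d i).
right; exists (fun i => complex.Re (d i)) => k; apply: complexI.
have mapX : complexify (M ^+ k) = complexify M ^+ k.
  elim: k => [|k IHk]; first by rewrite !expr0 /complexify map_mx1.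
  by rewrite !exprS -IHk -!mulmxE /complexify map_mxM.
transitivity (\tr (complexify (M ^+ k))); first by rewrite -trace_map_mx.
rewrite mapX tr_d rmorph_sum /=.
apply: eq_bigr => i _; rewrite rmorphXn /=; congr (_ ^+ _).
by case: (d i) (real_d i) => a b /= /eqP ->.
Qed.

(** * The Cauchy-Schwarz inequality *)

Lemma sum_Cauchy_Schwarz (R : realDomainType) n (a b : 'I_n -> R) :
  (\sum_i a i * b i) ^+ 2 <= (\sum_i a i ^+ 2) * (\sum_i b i ^+ 2).
Proof.
(* Lagrange's identity: twice the defect is a double sum of squares. *)
have Lagrange : \sum_i \sum_j (a i * b j - a j * b i) ^+ 2 =
    2 * ((\sum_i a i ^+ 2) * (\sum_i b i ^+ 2) - (\sum_i a i * b i) ^+ 2).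
  transitivity (\sum_i \sum_j (a i ^+ 2 * b j ^+ 2 + b i ^+ 2 * a j ^+ 2
                               - 2 * ((a i * b i) * (a j * b j)))).
    by apply: eq_bigr => i _; apply: eq_bigr => j _; ring.
  under eq_bigr => i _ do
    rewrite sumrB big_split /= -!mulr_sumr.
  by rewrite sumrB big_split /= -!mulr_suml -mulr_sumr -mulr_suml; ring.
have : 0 <= \sum_i \sum_j (a i * b j - a j * b i) ^+ 2.
  by apply: sumr_ge0 => i _; apply: sumr_ge0 => j _; apply: sqr_ge0.
by rewrite Lagrange; lra.
Qed.

(** * Traces of powers in terms of the symmetric and skew-symmetric parts *)

Lemma frobenius_sqE (R : realType) m n (A : 'M[R]_(m, n)) :
  frobenius_sq A = \tr (A *m A^T).
Proof.
apply: eq_bigr => i _; rewrite mxE; apply: eq_bigr => j _.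
by rewrite mxE expr2.
Qed.

Section SymSkew.
Variables (R : realType) (n : nat).
Implicit Types S A P Q : 'M[R]_n.

(** Transposition preserves the trace and turns [S A] into [- A S]. *)
Lemma mxtrace_sym_skew S A : S^T = S -> A^T = - A -> \tr (S *m A) = 0.
Proof.
move=> symS skewA; have : \tr (S *m A) = - \tr (S *m A).
  by rewrite -{1}mxtrace_tr trmx_mul symS skewA mulNmx raddfN mxtrace_mulC.
by lra.
Qed.

Lemma mxtrace_sqr_sym_skew S A : S^T = S -> A^T = - A ->
  \tr ((S + A) *m (S + A)) = \tr (S *m S) + \tr (A *m A).
Proof.
move=> symS skewA; rewrite mulmxDl !mulmxDr !mxtraceD.
rewrite [\tr (A *m S)]mxtrace_mulC (mxtrace_sym_skew symS skewA); ring.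
Qed.

Variables S A : 'M[R]_n.
Hypotheses (symS : S^T = S) (skewA : A^T = - A).

Let P := S *m S + A *m A.
Let Q := S *m A + A *m S.

Let symP : P^T = P.
Proof. by rewrite linearD /= !trmx_mul symS skewA mulNmx mulmxN opprK. Qed.

Let skewQ : Q^T = - Q.
Proof.
by rewrite linearD /= !trmx_mul symS skewA mulNmx mulmxN opprD addrC.
Qed.

Let sqrSA : (S + A) *m (S + A) = P + Q.
Proof.
by rewrite /P /Q mulmxDl !mulmxDr [RHS]addrACA [A *m A + _]addrC.
Qed.

(** The minus sign appears because [A * A = - A * A^T]. *)
Lemma mxtrace_sqr_parts :
  \tr ((S + A) ^+ 2) = frobenius_sq S - frobenius_sq A.
Proof.
rewrite expr2 -mulmxE mxtrace_sqr_sym_skew // !frobenius_sqE symS skewA.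
by rewrite mulmxN raddfN /= opprK.
Qed.

(** In [(S + A) (P + Q)] only [S P] and [A Q] have a nonzero trace. *)
Lemma mxtrace_cube_parts :
  \tr ((S + A) ^+ 3) = \tr (S ^+ 3) + 3 * \tr (S *m A ^+ 2).
Proof.
rewrite !(exprS _ 2) !expr2 -!mulmxE sqrSA mulmxDl !(mulmxDr _ P Q) !mxtraceD.
rewrite (mxtrace_sym_skew symS skewQ) [\tr (A *m P)]mxtrace_mulC.
rewrite (mxtrace_sym_skew symP skewA) /P /Q !mulmxDr !mxtraceD.
rewrite [\tr (A *m (S *m A))]mxtrace_mulC -mulmxA.
rewrite [A *m (A *m S)]mulmxA [\tr (A *m A *m S)]mxtrace_mulC.
ring.
Qed.

(** Apply [mxtrace_sqr_sym_skew] to [M^2 = P + Q]; the term in [S A] comes from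
    [\tr (S^2 A^2) = - frobenius_sq (S *m A)]. *)
Lemma mxtrace_pow4_parts :
  \tr ((S + A) ^+ 4) =
    frobenius_sq (S ^+ 2) + frobenius_sq (A ^+ 2) - 4 * frobenius_sq (S *m A)
    + 2 * \tr ((S *m A) ^+ 2).
Proof.
rewrite (exprM _ 2 2) !expr2 -!mulmxE sqrSA mxtrace_sqr_sym_skew //.
rewrite !frobenius_sqE !trmx_mul symS skewA /P /Q.
rewrite !mulmxDl !mulmxDr !(mulNmx, mulmxN, opprK) !mxtraceD !mulmxA raddfN /=.
(* Up to a cyclic shift, every word with two letters [S] and two letters [A]
   is one of [SSAA] and [SASA]. *)
have cycSAAS : \tr (S *m A *m A *m S) = \tr (S *m S *m A *m A).
  by rewrite mxtrace_mulC !mulmxA.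
have cycAASS : \tr (A *m A *m S *m S) = \tr (S *m S *m A *m A).
  by rewrite -[A *m A *m S *m S]mulmxA mxtrace_mulC !mulmxA.
have cycASSA : \tr (A *m S *m S *m A) = \tr (S *m S *m A *m A).
  by rewrite -!mulmxA mxtrace_mulC !mulmxA.
have cycASAS : \tr (A *m S *m A *m S) = \tr (S *m A *m S *m A).
  by rewrite -!mulmxA mxtrace_mulC !mulmxA.
rewrite cycSAAS cycAASS cycASSA cycASAS; ring.
Qed.

End SymSkew.

Lemma sym_part_sym (R : realType) n (M : 'M[R]_n) :
  (sym_part M)^T = sym_part M.
Proof. by rewrite /sym_part linearZ linearD /= trmxK addrC. Qed.

Lemma skew_part_skew (R : realType) n (M : 'M[R]_n) :
  (skew_part M)^T = - skew_part M.
Proof.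
by rewrite /skew_part linearZ linearB /= trmxK -scalerN opprB.
Qed.

Lemma sym_skew_partK (R : realType) n (M : 'M[R]_n) :
  sym_part M + skew_part M = M.
Proof.
by apply/matrixP => i j; rewrite !mxE; lra.
Qed.

Theorem theorem2p4 (R : realType) (n : nat) (M : 'M[R]_n) :
  let Ms := sym_part M in
  let Ma := skew_part M in
  [\/ n%:R * (frobenius_sq Ms - frobenius_sq Ma) < (\tr Ms) ^+ 2,
      n%:R * (frobenius_sq (Ms ^+ 2) + frobenius_sq (Ma ^+ 2) - 4 * frobenius_sq (Ms *m Ma)
              + 2 * \tr ((Ms *m Ma) ^+ 2))
        < (frobenius_sq Ms - frobenius_sq Ma) ^+ 2
    | (frobenius_sq Ms - frobenius_sq Ma)
        * (frobenius_sq (Ms ^+ 2) + frobenius_sq (Ma ^+ 2) - 4 * frobenius_sq (Ms *m Ma)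
           + 2 * \tr ((Ms *m Ma) ^+ 2))
        < (\tr (Ms ^+ 3) + 3 * \tr (Ms *m Ma ^+ 2)) ^+ 2] ->
  exists lambda : R[i],
    eigenvalue (complexify M) lambda /\ complex.Im lambda != 0.
Proof.
move=> Ms Ma; have [//|[x trM]] := nonreal_eigenvalue_or_mxtrace_expr M.
have symS : Ms^T = Ms := sym_part_sym M.
have skewA : Ma^T = - Ma := skew_part_skew M.
have trS : \tr Ms = \tr (M ^+ 1).
  rewrite expr1 -[in RHS](sym_skew_partK M) mxtraceD -/Ms -/Ma.
  by rewrite -[Ma]mul1mx mxtrace_sym_skew ?trmx1 // addr0.
rewrite -mxtrace_sqr_parts // -mxtrace_cube_parts // -mxtrace_pow4_parts //.
rewrite sym_skew_partK trS !trM.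
have sum1 : \sum_(i < n) (1 : R) ^+ 2 = n%:R.
  by under eq_bigr do rewrite expr1n; rewrite sumr_const card_ord.
case; rewrite ltNge => /negP[].
- rewrite -sum1; apply: le_trans (sum_Cauchy_Schwarz _ _).
  by under [in leRHS]eq_bigr do rewrite mul1r -[x _]expr1.
- have := sum_Cauchy_Schwarz (fun=> 1) (fun i => x i ^+ 2).
  rewrite sum1; under eq_bigr do rewrite mul1r.
  by under [X in _ <= _ * X]eq_bigr do rewrite -exprM.
- have := sum_Cauchy_Schwarz x (fun i => x i ^+ 2).
  under eq_bigr do rewrite -exprS.
  by under [X in _ <= _ * X]eq_bigr do rewrite -exprM.
Qed.
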